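(* The domination number of $H_{2,2}$ satisfies $\gamma(H_{2,2}) = 8$.
   Context: The infinite truncated square tiling graph $H_{\infty,\infty}$ has vertex set $\{(a,(x,y)) : a\in\mathbb{Z}_4,\ (x,y)\in\mathbb{Z}^2\}$. Its edges are: $(a,(x,y))\sim(a+1,(x,y))$ with $a+1$ taken modulo 4 (so each $(x,y)$ carries a 4-cycle whose vertices $0,1,2,3$ are its top, right, bottom, left vertices); $(1,(x,y))\sim(3,(x+1,y))$; and $(0,(x,y))\sim(2,(x,y+1))$. For $(x,y)\in\mathbb{Z}^2$ the octagon $O_{x,y}$ is the 8-cycle through $(0,(x,y)),(1,(x,y)),(3,(x+1,y)),(0,(x+1,y)),(2,(x+1,y+1)),(3,(x+1,y+1)),(1,(x,y+1)),(2,(x,y+1))$, in this cyclic order. For positive integers $m,n$, $H_{m,n}$ is the finite subgraph consisting of $m$ rows of $n$ octagons each: the union of the octagons $O_{x,y}$ with $0\le x\le n-1$, $0\le y\le m-1$. $\gamma(G)$ denotes the domination number of a finite graph $G$: the smallest cardinality of a set $T$ of vertices such that every vertex of $G$ is in $T$ or adjacent to a vertex of $T$. *)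

(* Defs.v *)
From mathcomp Require Import all_boot all_order all_algebra.

Set Implicit Arguments.
Unset Strict Implicit.
Unset Printing Implicit Defensive.

Import GRing.Theory.
Local Open Scope ring_scope.

Section Domination.
Variables (T : finType) (e : rel T).

Definition dominating (D : {set T}) : bool :=
  [forall v, (v \in D) || [exists u in D, e u v]].

Definition domination_number : nat :=
  #|[arg min_(D < [set: T] | dominating D) #|D|]|.

Lemma dominating_setT : dominating [set: T].
Proof. by apply/forallP => v; rewrite inE. Qed.

Lemma domination_numberP :
  (exists2 D, dominating D & #|D| = domination_number)
  /\ (forall D, dominating D -> domination_number <= #|D|)%N.
Proof.
rewrite /domination_number; case: arg_minnP; first exact: dominating_setT.
by move=> D domD minD; split=> //; exists D.
Qed.

End Domination.

(* [(a, (x, y))] is the top, right, bottom or left vertex of the 4-cycle at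
   [(x, y)] according to [a = 0, 1, 2, 3]. *)
Notation vertex := ('Z_4 * (int * int))%type.

Definition tiling_arc (u v : vertex) : bool :=
  let: (a, (x, y)) := u in
  [|| v == (a + 1, (x, y)),
      (a == 1) && (v == (3, (x + 1, y)))
    | (a == 0) && (v == (2, (x, y + 1)))].

Definition tiling_adj : rel vertex :=
  fun u v => tiling_arc u v || tiling_arc v u.

Lemma tiling_adj_sym : symmetric tiling_adj.
Proof. by move=> u v; rewrite /tiling_adj orbC. Qed.

Lemma tiling_adj_irr : irreflexive tiling_adj.
Proof.
case=> a [x y]; rewrite /tiling_adj orbb /tiling_arc !xpair_eqE.
by case: a => [[|[|[|[|a]]]] lt_a].
Qed.

Definition octagon (x y : int) : seq vertex :=
  [:: (0, (x, y)); (1, (x, y));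
      (3, (x + 1, y)); (0, (x + 1, y));
      (2, (x + 1, y + 1)); (3, (x + 1, y + 1));
      (1, (x, y + 1)); (2, (x, y + 1))].

Lemma octagon_ucycle x y : ucycle tiling_adj (octagon x y).
Proof.
have addx1 (z : int) : (z == z + 1) = false.
  by rewrite -subr_eq0 opprD addrA subrr.
have add1x (z : int) : (z + 1 == z) = false by rewrite eq_sym.
apply/andP; split.
  by rewrite /= /tiling_adj /tiling_arc /= !xpair_eqE !eqxx /= ?orbT.
by rewrite /= !inE !xpair_eqE !addx1 !add1x /= ?andbF.
Qed.

(* Adjacency in the simple cycle graph along [c].  The membership tests are
   needed because [next c u = u] when [u \notin c]. *)
Definition cycle_adj (c : seq vertex) : rel vertex :=
  fun u v => [&& u \in c, v \in c & (next c u == v) || (next c v == u)].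

(* [m] rows (indexed by [y]) of [n] octagons each (indexed by [x]). *)
Definition H_octagons (m n : nat) : seq (seq vertex) :=
  [seq octagon x%:Z y%:Z | y <- iota 0 m, x <- iota 0 n].

(* Vertices shared by several octagons are repeated in the [flatten], which is
   harmless: [seq_sub s] is the subtype of the [v] with [v \in s]. *)
Definition H_vertex (m n : nat) : finType :=
  seq_sub (flatten (H_octagons m n)).

Definition H_adj (m n : nat) : rel (H_vertex m n) :=
  fun u v => has (fun c => cycle_adj c (val u) (val v)) (H_octagons m n).

Lemma cycle_adj_tiling x y u v :
  cycle_adj (octagon x y) u v -> tiling_adj u v.
Proof.
have /andP[cyc _] := octagon_ucycle x y.
case/and3P=> uc vc /orP[] /eqP <-; first exact: next_cycle.
by rewrite tiling_adj_sym; apply: next_cycle.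
Qed.

Lemma H_adj_tiling m n (u v : H_vertex m n) :
  H_adj u v -> tiling_adj (val u) (val v).
Proof.
by case/hasP=> c /allpairsP[[y x] [_ _ ->]]; apply: cycle_adj_tiling.
Qed.

Lemma H_adj_sym m n : symmetric (@H_adj m n).
Proof.
by move=> u v; apply: eq_has => c; rewrite /cycle_adj orbC andbCA.
Qed.

Lemma H_adj_irr m n : irreflexive (@H_adj m n).
Proof.
by move=> u; apply/negP => /H_adj_tiling; rewrite tiling_adj_irr.
Qed.

(* Main.v *)
Require Import Defs.
From mathcomp Require Import all_boot all_order all_algebra.

Set Implicit Arguments.
Unset Strict Implicit.
Unset Printing Implicit Defensive.

(** The graph consists of an outer cycle of 20 vertices and a central 4-cycle,
    joined by four edges: each central vertex is adjacent to the middle vertex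
    of one side of the outer cycle.  Going around, the outer cycle alternates
    between the pairs of vertices at the four corner squares and the triples at
    the four side squares, whose middle vertices are the ends of the joining
    edges.

    Upper bound: the four middle vertices dominate the side squares and the
    central cycle, and one vertex at each corner dominates both vertices of
    that corner.  These are 8 vertices.

    Lower bound: double counting ([size_le_sum_count]) compares a list of
    vertices to be dominated with the number of its members that each vertex of
    the dominating set [D] can dominate.  There are two cases.
    - If [D] contains a central vertex, count on the outer cycle.  That vertex
      dominates only one outer vertex, and any vertex dominates at most three
      of them, so [20 <= 1 + 3 * (#|D| - 1)], which forces [8 <= #|D|].
    - If [D] avoids the central cycle, count on the four central vertices and
      one vertex from each corner.  A vertex outside the central cycle dominates
      at most one of these eight, so again [8 <= #|D|]. *)

Definition dominates (T : eqType) (e : rel T) (u v : T) : bool :=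
  (u == v) || e u v.

Lemma dominatingP (T : finType) (e : rel T) (D : {set T}) :
  reflect (forall v, exists2 u, u \in D & dominates e u v) (dominating e D).
Proof.
apply: (iffP forallP) => domD v.
  have /orP[vD | /exists_inP[u uD euv]] := domD v.
    by exists v; rewrite // /dominates eqxx.
  by exists u; rewrite // /dominates euv orbT.
have [u uD /orP[/eqP <- | euv]] := domD v; first by rewrite uD.
by apply/orP; right; apply/exists_inP; exists u.
Qed.

(** Double counting of the pairs formed by an element of [D] and an entry of
    [s] that it dominates: every entry occurs in at least one pair. *)
Lemma size_le_sum_count (T : finType) (e : rel T) (D : {set T}) (s : seq T) :
  dominating e D -> size s <= \sum_(u in D) count (dominates e u) s.
Proof.
move=> /dominatingP domD; elim: s => [|v s IHs] //=.
rewrite big_split -add1n leq_add //.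
by have [u uD uv] := domD v; rewrite (bigD1 u) //= uv.
Qed.

(** * Adjacency on bare vertices *)

(** The same adjacency as [H_adj], but on all the vertices of the tiling rather
    than on a subtype, so that finite checks reduce to evaluating a boolean on
    explicit lists. *)
Definition bare_adj (m n : nat) : rel vertex :=
  fun u v => has (fun c => cycle_adj c u v) (H_octagons m n).

Lemma dominates_val m n (u v : H_vertex m n) :
  dominates (@H_adj m n) u v = dominates (bare_adj m n) (val u) (val v).
Proof. by []. Qed.

Lemma size_le_sum_count_bare m n (D : {set H_vertex m n}) (s : seq vertex) :
  {subset s <= flatten (H_octagons m n)} -> dominating (@H_adj m n) D ->
  size s <= \sum_(u in D) count (dominates (bare_adj m n) (val u)) s.
Proof.
move=> sH domD; pose t : seq (H_vertex m n) := pmap insub s.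
have val_t : map val t = s.
  rewrite /t (pmap_filter (insubK _)); apply/all_filterP/allP => v /sH vH.
  by rewrite insubT.
rewrite -val_t size_map (leq_trans (size_le_sum_count t domD)) //.
by apply: leq_sum => u _; rewrite count_map leqnn.
Qed.

(** Turns an explicit list into a dominating set.  Repeated entries do no harm:
    they only make the list longer than the set of its entries. *)
Lemma domination_number_le_size m n (s : seq vertex) :
  {subset s <= flatten (H_octagons m n)} ->
  {in flatten (H_octagons m n),
    forall v, has (dominates (bare_adj m n) ^~ v) s} ->
  domination_number (@H_adj m n) <= size s.
Proof.
move=> sH doms; pose D : {set H_vertex m n} := [set u in pmap insub s].
have [_ minD] := domination_numberP (@H_adj m n).
have domD : dominating (@H_adj m n) D.
  apply/dominatingP => v; have /hasP[u us uv] := doms _ (valP v).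
  exists (Sub u (sH _ us)); last by rewrite dominates_val SubK.
  by rewrite inE mem_pmap_sub SubK.
apply: leq_trans (minD _ domD) _; rewrite cardsE.
by rewrite (leq_trans (card_size _)) // size_pmap_sub count_size.
Qed.

(** * The graph with two rows of two octagons *)

Section TwoByTwo.
Local Open Scope ring_scope.

Definition central (v : vertex) : bool := v.2 == (1, 1).

Definition central_cycle : seq vertex :=
  [:: (0, (1, 1)); (1, (1, 1)); (2, (1, 1)); (3, (1, 1))].

(** The neighbours of the central cycle. *)
Definition side_middles : seq vertex :=
  [:: (0, (1, 0)); (3, (2, 1)); (2, (1, 2)); (1, (0, 1))].

(** One representative of each pair of adjacent corner vertices. *)
Definition corners : seq vertex :=
  [:: (0, (0, 0)); (0, (2, 0)); (2, (2, 2)); (2, (0, 2))].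

Definition outer_cycle : seq vertex :=
  [seq v <- undup (flatten (H_octagons 2 2)) | ~~ central v].

End TwoByTwo.

Lemma size_outer_cycle : size outer_cycle = 20.
Proof. by vm_compute. Qed.

Lemma outer_cycle_sub : {subset outer_cycle <= flatten (H_octagons 2 2)}.
Proof. by move=> v; rewrite mem_filter mem_undup => /andP[]. Qed.

Lemma count_outer_le3 (u : H_vertex 2 2) :
  count (dominates (bare_adj 2 2) (val u)) outer_cycle <= 3.
Proof.
have /allP check : all
    (fun u => count (dominates (bare_adj 2 2) u) outer_cycle <= 3)
    (flatten (H_octagons 2 2)) by vm_compute.
exact: check (valP u).
Qed.

Lemma central_count_outer_le1 (u : H_vertex 2 2) : central (val u) ->
  count (dominates (bare_adj 2 2) (val u)) outer_cycle <= 1.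
Proof.
have /allP check : all
    (fun u => central u ==>
       (count (dominates (bare_adj 2 2) u) outer_cycle <= 1))
    (flatten (H_octagons 2 2)) by vm_compute.
exact/implyP/(check _ (valP u)).
Qed.

(** A middle vertex dominates one central vertex and no corner vertex; any other
    outer vertex dominates no central vertex, and its closed neighbourhood meets
    the pair of vertices of only one corner. *)
Lemma outer_count_centre_corners_le1 (u : H_vertex 2 2) : ~~ central (val u) ->
  count (dominates (bare_adj 2 2) (val u)) (central_cycle ++ corners) <= 1.
Proof.
have /allP check : all
    (fun u => ~~ central u ==>
       (count (dominates (bare_adj 2 2) u) (central_cycle ++ corners) <= 1))
    (flatten (H_octagons 2 2)) by vm_compute.
exact/implyP/(check _ (valP u)).
Qed.

Lemma dominating_ge8_of_central (D : {set H_vertex 2 2}) (w : H_vertex 2 2) :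
  dominating (@H_adj 2 2) D -> w \in D -> central (val w) -> 8 <= #|D|.
Proof.
move=> domD wD cw; have := size_le_sum_count_bare outer_cycle_sub domD.
rewrite size_outer_cycle (big_setD1 w) //= (cardsD1 w) wD => le20.
have le_rest : \sum_(u in D :\ w)
    count (dominates (bare_adj 2 2) (val u)) outer_cycle <= #|D :\ w| * 3.
  by rewrite -sum_nat_const leq_sum // => u _; apply: count_outer_le3.
have {le20} := leq_trans le20 (leq_add (central_count_outer_le1 cw) le_rest).
(* 19 outer vertices are left, and six vertices dominate at most 18. *)
by rewrite !add1n !ltnS -[18]/(6 * 3) ltn_pmul2r.
Qed.

Lemma dominating_ge8_of_outer (D : {set H_vertex 2 2}) :
  dominating (@H_adj 2 2) D -> {in D, forall u, ~~ central (val u)} ->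
  8 <= #|D|.
Proof.
move=> domD outD.
have sub : {subset central_cycle ++ corners <= flatten (H_octagons 2 2)}.
  by apply/allP; vm_compute.
apply: leq_trans (size_le_sum_count_bare sub domD) _.
rewrite -sum1_card leq_sum // => u uD.
exact: outer_count_centre_corners_le1 (outD u uD).
Qed.

Theorem theorem2p5 : domination_number (@H_adj 2 2) = 8.
Proof.
apply/eqP; rewrite eqn_leq; apply/andP; split.
  apply: (@domination_number_le_size 2 2 (side_middles ++ corners)).
    by apply/allP; vm_compute.
  by apply/allP; vm_compute.
have [[D domD <-] _] := domination_numberP (@H_adj 2 2).
have [/exists_inP[w wD cw] | noc] := boolP [exists w in D, central (val w)].
  exact: dominating_ge8_of_central domD wD cw.
apply: dominating_ge8_of_outer domD _ => u uD.
by apply: contra noc => cu; apply/exists_inP; exists u.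
Qed.
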